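(* Let $T_{\min}>0$ and assume that the flow data depend only on the timer $\tau=t-t_k$ and are time-invariant beyond $T_{\min}$, and that the jump data are $k$-independent: $$\mathcal F(\tau,\cdot)\equiv\mathcal F_\infty(\cdot),\quad Z(\tau)\equiv Z(T_{\min})\ \text{ for }\tau\ge T_{\min},\qquad \mathcal J(k,\cdot)\equiv\mathcal J(\cdot),\quad Z_k\equiv Z_{\mathrm{jp}}\ \text{ for all }k.$$ Suppose there exists a piecewise-$C^1$ function $P_s:[0,T_{\min}]\to\mathbb H^n_{\succeq0}$ satisfying: (i) for all $\tau\in(0,T_{\min})$, $\mathcal C_Z(\tau,P_s(\tau))\succeq0$ and its generalized Schur complement vanishes, $(\mathcal C_Z)_1-(\mathcal C_Z)_2(\mathcal C_Z)_3^\dagger(\mathcal C_Z)_2^*=0$; (ii) $\mathcal D_Z(P_s(0^+),P_s(T_{\min}))\succeq0$ and its generalized Schur complement vanishes, $(\mathcal D_Z)_1-(\mathcal D_Z)_2(\mathcal D_Z)_3^\dagger(\mathcal D_Z)_2^*=0$; (iii) (Geromel–Colaneri stability condition) $\mathcal C_Z^0(P_s(T_{\min})):=\mathcal F_\infty^*(P_s(T_{\min}))+Z(T_{\min})\preceq0$. Then for any dwell-time sequence with $\Delta_k=t_{k+1}-t_k\ge T_{\min}$, the policy $K(\tau)\in\mathcal K_c(\tau,P_s(\tau))$ for $\tau\in[0,T_{\min}]$, $K(\tau)=K(T_{\min})$ for $\tau>T_{\min}$ on flow, and $K_k\in\mathcal K_d(P_s(0^+),P_s(T_{\min}))$ at each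 jump, is causal and achieves $J_T(X^\star,X_1^0)\le\langle P_s(0),X_1^0\rangle$ for all $T>0$, where $X^\star$ is the resulting trajectory. In particular, $J_\infty^\star(X_1^0)\le\langle P_s(0),X_1^0\rangle$. The conditions (i)–(iii) are verifiable on $[0,T_{\min}]$ alone, without knowledge of future dwell-times.
   Context: Notation. Fix integers $n,m\ge1$. $\mathbb H^p$, $\mathbb H^p_{\succeq0}$: $p\times p$ complex Hermitian, resp. positive semidefinite, matrices; $\langle A,B\rangle=\operatorname{trace}(AB^* )$; $A^\dagger$ is the Moore–Penrose pseudoinverse. $E=[I_n\ \ 0]\in\mathbb C^{n\times(n+m)}$. Write $X=\begin{bmatrix}X_1&X_2^*\\ X_2&X_3\end{bmatrix}$ with $X_1=EXE^*$. System. Initial time $t_0$, jump times $t_1<t_2<\cdots$, $t_k\to\infty$; timer $\tau(t)=t-t_k$ for $t\in[t_k,t_{k+1})$, $k\ge0$. Dynamics $$E\dot X(t)E^*=\mathcal F(\tau(t),X(t))\ (t\ne t_k),\quad EX(t_k^+)E^*=\mathcal J(X(t_k^-)),\quad EX(t_0)E^*=X_1^0\in\mathbb H^n_{\succeq0}.$$ $\mathcal F(\tau,\cdot),\mathcal J:\mathbb H^{n+m}\to\mathbb H^n$ are linear and bounded, $\mathcal F$ is continuous in $\tau$, both leave the positive semidefinite cone invariant (the state block stays positive semidefinite); adjoints: $\langle P,\mathcal F(\tau,X)\rangle=\langle\mathcal F^*(\tau,P),X\rangle$, $\langle P,\mathcal J(X)\rangle=\langle\mathcal J^*(P),X\rangle$.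 A trajectory is an $\mathbb H^{n+m}_{\succeq0}$-valued function satisfying these equations (regular enough that the limits and integrals involved make sense); $X_2,X_3$ are free. A policy with flow gain $K$ and jump gains $K_k$ means $X_2=KX_1$, $X_3=KX_1K^*$ on flow, and the same with $K_k$ at $t_k^-$. A policy depending only on $X_1$ and $\tau$ is causal. Cost. $Z(\tau)\succeq0$, $Z_{\mathrm{jp}}\succeq0$ in $\mathbb H^{n+m}$; $J_T(X,X_1^0)=\int_{t_0}^{t_0+T}\langle Z(\tau(t)),X(t)\rangle dt+\sum_{t_k\in(t_0,t_0+T)}\langle Z_{\mathrm{jp}},X(t_k^-)\rangle$ (no terminal cost); $J_\infty$ is the same with $T=\infty$ and $J_\infty^\star(X_1^0)$ is its infimum over trajectories. Operators. $\mathcal C_Z(\tau,P(\tau))=E^*\tfrac{dP}{d\tau}(\tau)E+\mathcal F^*(\tau,P(\tau))+Z(\tau)$, $\mathcal D_Z(P^+,P^-)=\mathcal J^*(P^+)-E^*P^-E+Z_{\mathrm{jp}}$. Matrices $\mathcal L\in\mathbb H^{n+m}$ are partitioned as $\begin{bmatrix}\mathcal L_1&\mathcal L_2\\ \mathcal L_2^*&\mathcal L_3\end{bmatrix}$ with $\mathcal L_1\in\mathbb H^n$, $\mathcal L_3\in\mathbb H^m$. Gain sets: $\mathcal K_c(\tau,P(\tau))=\{K\in\mathbb C^{m\times n}:(\mathcal C_Z)_3K+(\mathcal C_Z)_2^*=0\}$, $\mathcal K_d(P^+,P^-)=\{K\in\mathbb C^{m\times n}:(\mathcal D_Z)_3K+(\mathcal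 D_Z)_2^*=0\}$ (note $(\mathcal C_Z)_2,(\mathcal C_Z)_3$ do not involve the derivative of $P$). $P_s(0)$ denotes $P_s(0^+)$.
   Formalization: Both bounds, including the one on J_∞^⋆, are stated assuming that the closed-loop trajectory X^⋆ of the chosen policy exists; if (C_Z)_3 degenerates the gain can blow up, no X^⋆ exists, and the bound on J_∞^⋆ can fail. P_s is taken continuous. *)

(* Defs.v *)
From mathcomp Require Import all_boot all_order all_algebra.
From mathcomp Require Import complex.
From mathcomp Require Import all_classical all_reals all_analysis.
Set Implicit Arguments.
Unset Strict Implicit.
Unset Printing Implicit Defensive.
Import Order.TTheory GRing.Theory Num.Theory.
Import numFieldNormedType.Exports.
Local Open Scope classical_set_scope.
Local Open Scope ring_scope.
Local Open Scope complex_scope.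
Local Open Scope sesquilinear_scope.

Section Matrices.
Context {R : realType}.
Local Notation C := R[i].

(* [A^t*] is the conjugate transpose; [0 <= z] in [R[i]] says that [z] is real
   and nonnegative. *)
Definition psdmx p (A : 'M[C]_p) : Prop :=
  A \is hermsymmx /\ forall v : 'cV[C]_p, 0 <= (v^t* *m A *m v) 0 0.

Definition nsdmx p (A : 'M[C]_p) : Prop := psdmx (- A).

Definition mxdot p q (A B : 'M[C]_(p, q)) : C := \tr (A *m B^t*).

(* [mxdot A B] is a real number when [A] and [B] are Hermitian. *)
Definition mxdotR p q (A B : 'M[C]_(p, q)) : R := complex.Re (mxdot A B).

Definition frobenius p q (A : 'M[C]_(p, q)) : R := Num.sqrt (mxdotR A A).

Definition moore_penrose p q (A : 'M[C]_(p, q)) (G : 'M[C]_(q, p)) : Prop :=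
  [/\ A *m G *m A = A, G *m A *m G = G,
      (A *m G)^t* = A *m G & (G *m A)^t* = G *m A].

Definition mpinv p q (A : 'M[C]_(p, q)) : 'M[C]_(q, p) :=
  xget 0 [set G | moore_penrose A G].

Lemma ctrmxM p q r (A : 'M[C]_(p, q)) (B : 'M[C]_(q, r)) :
  (A *m B)^t* = B^t* *m A^t*.
Proof. by rewrite trmx_mul map_mxM. Qed.

Lemma ctrmxK p q (A : 'M[C]_(p, q)) : (A^t*)^t* = A.
Proof. by apply/matrixP => i j; rewrite !mxE conjCK. Qed.

Lemma gram_unitmx p r (A : 'M[C]_(p, r)) : \rank A = r -> A^t* *m A \in unitmx.
Proof.
move=> rA; rewrite -row_free_unit -kermx_eq0; apply/rowV0P => v /sub_kermxP vA.
have /eqP : dotmx (v *m A^t*) (v *m A^t*) = 0.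
  by rewrite dotmxE ctrmxM ctrmxK mulmxA -(mulmxA v) vA mul0mx mxE.
rewrite dnorm_eq0 => /eqP vA0.
have fA : row_free (A^t*) by rewrite /row_free mxrank_map mxrank_tr rA.
by apply/eqP; rewrite -(mulmx_free_eq0 v fA) vA0.
Qed.

Lemma moore_penrose_uniq p q (A : 'M[C]_(p, q)) G H :
  moore_penrose A G -> moore_penrose A H -> G = H.
Proof.
move=> [aga gag hag hga] [aha hah hah' hha].
have e1 : A *m G = A *m H.
  rewrite -[in LHS]aha -(mulmxA (A *m H)) -hah' -[in LHS]hag -ctrmxM.
  by rewrite mulmxA aga.
have e2 : G *m A = H *m A.
  rewrite -[in LHS]aha -(mulmxA A) mulmxA -hga -[in LHS]hha -ctrmxM.
  by rewrite -mulmxA (mulmxA A) aga.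
by rewrite -gag e2 -mulmxA e1 mulmxA hah.
Qed.

Lemma moore_penrose_factor p q r (B : 'M[C]_(p, r)) (D : 'M[C]_(r, q)) :
  \rank B = r -> \rank D = r ->
  moore_penrose (B *m D)
    (D^t* *m invmx (D *m D^t*) *m invmx (B^t* *m B) *m B^t*).
Proof.
move=> rB rD.
have uB := gram_unitmx rB.
have uD : D *m D^t* \in unitmx.
  by rewrite -[X in X *m _]ctrmxK gram_unitmx // mxrank_map mxrank_tr.
set U := invmx (B^t* *m B); set V := invmx (D *m D^t*).
have UE : U *m (B^t* *m B) = 1%:M by rewrite mulVmx.
have VE : (D *m D^t*) *m V = 1%:M by rewrite mulmxV.
have Ut : U^t* = U by rewrite trmx_inv map_invmx ctrmxM ctrmxK.
have Vt : V^t* = V by rewrite trmx_inv map_invmx ctrmxM ctrmxK.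
set G := _ *m B^t*.
have AG : B *m D *m G = B *m U *m B^t*.
  have -> : B *m D *m G = B *m (D *m D^t* *m V) *m U *m B^t*.
    by rewrite /G !mulmxA.
  by rewrite VE mulmx1.
have GA : G *m (B *m D) = D^t* *m V *m D.
  have -> : G *m (B *m D) = D^t* *m V *m (U *m (B^t* *m B)) *m D.
    by rewrite /G !mulmxA.
  by rewrite UE mulmx1.
split.
- rewrite AG; have -> : B *m U *m B^t* *m (B *m D) = B *m (U *m (B^t* *m B)) *m D.
    by rewrite !mulmxA.
  by rewrite UE mulmx1.
- rewrite GA.
  have -> : D^t* *m V *m D *m G = D^t* *m V *m (D *m D^t* *m V) *m U *m B^t*.
    by rewrite /G !mulmxA.
  by rewrite VE mulmx1.
- by rewrite AG !ctrmxM ctrmxK Ut mulmxA.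
- by rewrite GA !ctrmxM ctrmxK Vt mulmxA.
Qed.

Lemma mpinvP p q (A : 'M[C]_(p, q)) : moore_penrose A (mpinv A).
Proof.
suff [G AG] : exists G, moore_penrose A G by apply: (xgetPex 0 (ex_intro _ G AG)).
have rB : \rank (col_base A) = \rank A by apply/eqP; exact: col_base_full.
have rD : \rank (row_base A) = \rank A by apply/eqP; exact: row_base_free.
have := moore_penrose_factor rB rD; rewrite mulmx_base => AG.
by eexists; exact: AG.
Qed.

End Matrices.

Section MatrixFunctions.
Context {R : realType}.
Local Notation C := R[i].

(* Regularity of matrix-valued functions of a real variable is imposed on the
   real and imaginary part of every entry. *)
Definition mx_parts (Q : (R -> R) -> Prop) p q (M : R -> 'M[C]_(p, q)) : Prop :=
  forall i j, Q (fun t => complex.Re (M t i j)) /\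
              Q (fun t => complex.Im (M t i j)).

Definition mxderivable p q (M : R -> 'M[C]_(p, q)) (t : R) : Prop :=
  mx_parts (fun f => derivable f t 1) M.

Definition mxderive p q (M : R -> 'M[C]_(p, q)) (t : R) : 'M[C]_(p, q) :=
  \matrix_(i, j) (derive1 (fun s => complex.Re (M s i j)) t +i*
                  derive1 (fun s => complex.Im (M s i j)) t).

(* [f] is C^1 on the closed interval [a, b]: its derivative on the open
   interval has a continuous extension [g] to the closed one. *)
Definition C1_on (a b : R) (f : R -> R) : Prop :=
  exists g : R -> R, {within `[a, b], continuous g} /\
    forall x, a < x < b -> is_derive x 1 f (g x).

(* Piecewise C^1: continuous, and C^1 on each interval of a finite
   subdivision. *)
Definition piecewise_C1 (a b : R) (f : R -> R) : Prop :=
  {within `[a, b], continuous f} /\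
  exists s : seq R, [/\ path <%R a s, last a s = b &
    forall i, (i < size s)%N -> C1_on (nth 0 (a :: s) i) (nth 0 s i) f].

Definition abs_continuous (a b : R) (f : R -> R) : Prop :=
  forall e : R, 0 < e -> exists2 d : R, 0 < d &
    forall s : seq (R * R),
      all (fun I => [&& a <= I.1, I.1 <= I.2 & I.2 <= b]) s ->
      pairwise (fun I J => (I.2 <= J.1) || (J.2 <= I.1)) s ->
      \sum_(I <- s) (I.2 - I.1) < d ->
      \sum_(I <- s) `|f I.2 - f I.1| < e.

End MatrixFunctions.

Section HermitianOperators.
Context {R : realType}.
Local Notation C := R[i].

(* A bounded R-linear operator [L] from the p x p to the q x q Hermitian
   matrices together with its adjoint [Ladj]; the values of [L] and [Ladj] at
   matrices that are not Hermitian are irrelevant. *)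
Record herm_operator p q (L : 'M[C]_p -> 'M[C]_q) (Ladj : 'M[C]_q -> 'M[C]_p)
    : Prop := HermOperator {
  herm_stable : forall X, X \is hermsymmx -> L X \is hermsymmx;
  herm_linear : forall (a : R) X Y, X \is hermsymmx -> Y \is hermsymmx ->
    L (a%:C *: X + Y) = a%:C *: L X + L Y;
  herm_bounded : exists c : R, forall X, X \is hermsymmx ->
    frobenius (L X) <= c * frobenius X;
  herm_adj_stable : forall P, P \is hermsymmx -> Ladj P \is hermsymmx;
  herm_adjoint : forall P X, P \is hermsymmx -> X \is hermsymmx ->
    mxdot P (L X) = mxdot (Ladj P) X }.

End HermitianOperators.

Section HybridSystems.
Context {R : realType} {n m : nat}.
Local Notation C := R[i].

Definition Emx : 'M[C]_(n, n + m) := row_mx 1%:M 0.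

Definition state (X : 'M[C]_(n + m)) : 'M[C]_n := Emx *m X *m Emx^t*.

(* X_2 = K X_1 and X_3 = K X_1 K^*. *)
Definition uses_gain (K : 'M[C]_(m, n)) (X : 'M[C]_(n + m)) : Prop :=
  dlsubmx X = K *m state X /\ drsubmx X = K *m state X *m K^t*.

(* [X] solves E X' E^* = F (s, X) on [a, b] in the sense of Caratheodory; only
   the state block is differentiated, the other blocks being free. *)
Definition flow_solution (F : R -> 'M[C]_(n + m) -> 'M[C]_n)
    (X : R -> 'M[C]_(n + m)) (a b : R) : Prop :=
  mx_parts (abs_continuous a b) (fun s => state (X s)) /\
  {ae lebesgue_measure, forall s : R, a < s < b ->
    mxderivable (fun r => state (X r)) s /\
    mxderive (fun r => state (X r)) s = F s (X s)}.

(* The flow keeps the state block positive semidefinite under any continuous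
   feedback. *)
Definition flow_invariant (F : R -> 'M[C]_(n + m) -> 'M[C]_n) : Prop :=
  forall (K : R -> 'M[C]_(m, n)) (X : R -> 'M[C]_(n + m)) (a b : R),
    0 <= a <= b ->
    mx_parts (fun f => {within `[a, b], continuous f}) K ->
    (forall s, a <= s <= b -> X s \is hermsymmx /\ uses_gain (K s) (X s)) ->
    flow_solution F X a b ->
    psdmx (state (X a)) -> forall s, a <= s <= b -> psdmx (state (X s)).

Record hybrid_system := HybridSystem {
  flow : R -> 'M[C]_(n + m) -> 'M[C]_n;
  flow_adj : R -> 'M[C]_n -> 'M[C]_(n + m);
  jump : 'M[C]_(n + m) -> 'M[C]_n;
  jump_adj : 'M[C]_n -> 'M[C]_(n + m);
  flow_cost : R -> 'M[C]_(n + m);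
  jump_cost : 'M[C]_(n + m) }.

Record hybrid_axioms (Sys : hybrid_system) : Prop := HybridAxioms {
  flow_operator : forall tau, 0 <= tau ->
    herm_operator (flow Sys tau) (flow_adj Sys tau);
  flow_continuous : forall X, X \is hermsymmx ->
    mx_parts (fun f => {within `[0, +oo[, continuous f}) (flow Sys ^~ X);
  flow_psd : flow_invariant (flow Sys);
  jump_operator : herm_operator (jump Sys) (jump_adj Sys);
  jump_psd : forall X, psdmx X -> psdmx (jump Sys X);
  flow_cost_psd : forall tau, 0 <= tau -> psdmx (flow_cost Sys tau);
  jump_cost_psd : psdmx (jump_cost Sys) }.

(* [t 0] is the initial time, [t k] with [0 < k] are the jump times. *)
Definition jump_times (t : nat -> R) : Prop :=
  (forall k, t k < t k.+1) /\ (t k @[k --> \oo] --> +oo).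

Definition timer (t : nat -> R) (s : R) : R :=
  s - t (xget 0%N [set k | t k <= s < t k.+1]).

(* A trajectory is a pair: [X s] is the value at time [s], post-jump when [s] is
   a jump time, and [Xm k] is X(t_k^-) for [0 < k]. Only the state block of
   [Xm k] is the left limit of the flow, the inputs at t_k^- being free. *)
Record trajectory (Sys : hybrid_system) (t : nat -> R) (X10 : 'M[C]_n)
    (X : R -> 'M[C]_(n + m)) (Xm : nat -> 'M[C]_(n + m)) : Prop := Trajectory {
  traj_psd : forall s, t 0%N <= s -> psdmx (X s);
  traj_pre_psd : forall k, psdmx (Xm k.+1);
  traj_init : state (X (t 0%N)) = X10;
  traj_flow : forall k b, t k <= b < t k.+1 ->
    flow_solution (fun s => flow Sys (timer t s)) X (t k) b;
  traj_left_limit : forall k i j,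
    complex.Re (state (X s) i j) @[s --> (t k.+1)^'-]
      --> complex.Re (state (Xm k.+1) i j) /\
    complex.Im (state (X s) i j) @[s --> (t k.+1)^'-]
      --> complex.Im (state (Xm k.+1) i j);
  traj_jump : forall k, state (X (t k.+1)) = jump Sys (Xm k.+1);
  traj_cost_measurable : measurable_fun `[t 0%N, +oo[
    (fun s => mxdotR (flow_cost Sys (timer t s)) (X s)) }.

Definition cost_T (Sys : hybrid_system) (t : nat -> R)
    (X : R -> 'M[C]_(n + m)) (Xm : nat -> 'M[C]_(n + m)) (T : R) : \bar R :=
  (\int[lebesgue_measure]_(s in `[t 0%N, (t 0%N + T)%R])
      (mxdotR (flow_cost Sys (timer t s)) (X s))%:E
   + \sum_(0 <= k <oo | (t 0%N < t k < t 0%N + T)%R)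
      (mxdotR (jump_cost Sys) (Xm k))%:E)%E.

Definition cost_infty (Sys : hybrid_system) (t : nat -> R)
    (X : R -> 'M[C]_(n + m)) (Xm : nat -> 'M[C]_(n + m)) : \bar R :=
  (\int[lebesgue_measure]_(s in `[t 0%N, +oo[)
      (mxdotR (flow_cost Sys (timer t s)) (X s))%:E
   + \sum_(0 <= k <oo | (t 0%N < t k)%R)
      (mxdotR (jump_cost Sys) (Xm k))%:E)%E.

Definition optimal_cost (Sys : hybrid_system) (t : nat -> R) (X10 : 'M[C]_n)
    : \bar R :=
  ereal_inf [set v | exists X Xm,
    trajectory Sys t X10 X Xm /\ v = cost_infty Sys t X Xm].

(* A policy chooses the gains from the jump times, the state signal [x] and its
   pre-jump values [xm], at time [s] on flow and at t_k^- at the k-th jump. *)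
Record policy := Policy {
  flow_gain : (nat -> R) -> (R -> 'M[C]_n) -> (nat -> 'M[C]_n) -> R ->
    'M[C]_(m, n);
  jump_gain : (nat -> R) -> (R -> 'M[C]_n) -> (nat -> 'M[C]_n) -> nat ->
    'M[C]_(m, n) }.

Definition gain_policy (K : R -> 'M[C]_(m, n)) (Kj : nat -> 'M[C]_(m, n)) :=
  Policy (fun t _ _ s => K (timer t s)) (fun _ _ _ k => Kj k).

(* The gains are determined by the jump times and the state values up to the
   present instant; in particular they ignore future dwell times. *)
Definition causal (pol : policy) : Prop :=
  forall (t t' : nat -> R) (x x' : R -> 'M[C]_n) (xm xm' : nat -> 'M[C]_n),
    jump_times t -> jump_times t' -> t 0%N = t' 0%N ->
    (forall s, t 0%N <= s ->
       (forall k, t k <= s \/ t' k <= s -> t k = t' k) ->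
       (forall k, t k.+1 <= s -> xm k.+1 = xm' k.+1) ->
       (forall r, t 0%N <= r <= s -> x r = x' r) ->
       flow_gain pol t x xm s = flow_gain pol t' x' xm' s) /\
    (forall k,
       (forall j, (j <= k.+1)%N -> t j = t' j) ->
       (forall j, (j <= k)%N -> xm j.+1 = xm' j.+1) ->
       (forall r, t 0%N <= r < t k.+1 -> x r = x' r) ->
       jump_gain pol t x xm k.+1 = jump_gain pol t' x' xm' k.+1).

Definition follows (pol : policy) (t : nat -> R)
    (X : R -> 'M[C]_(n + m)) (Xm : nat -> 'M[C]_(n + m)) : Prop :=
  (forall s, t 0%N <= s ->
     uses_gain (flow_gain pol t (state \o X) (state \o Xm) s) (X s)) /\
  (forall k,
     uses_gain (jump_gain pol t (state \o X) (state \o Xm) k.+1) (Xm k.+1)).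

(* [mxderive] is total; where [P] is not differentiable only the top left block
   of [C_Z] is meaningless. *)
Definition C_Z (Sys : hybrid_system) (tau : R) (P : R -> 'M[C]_n)
    : 'M[C]_(n + m) :=
  Emx^t* *m mxderive P tau *m Emx + flow_adj Sys tau (P tau) + flow_cost Sys tau.

Definition D_Z (Sys : hybrid_system) (Pp Pm : 'M[C]_n) : 'M[C]_(n + m) :=
  jump_adj Sys Pp - Emx^t* *m Pm *m Emx + jump_cost Sys.

Definition schur (L : 'M[C]_(n + m)) : 'M[C]_n :=
  ulsubmx L - ursubmx L *m mpinv (drsubmx L) *m (ursubmx L)^t*.

Definition gain_set (L : 'M[C]_(n + m)) : set 'M[C]_(m, n) :=
  [set K | drsubmx L *m K + (ursubmx L)^t* = 0].

Definition K_c (Sys : hybrid_system) (tau : R) (P : R -> 'M[C]_n) :=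
  gain_set (C_Z Sys tau P).

Definition K_d (Sys : hybrid_system) (Pp Pm : 'M[C]_n) :=
  gain_set (D_Z Sys Pp Pm).

Lemma jump_times_lt (t : nat -> R) :
  jump_times t -> {homo t : i j / (i < j)%N >-> i < j}.
Proof. by move=> [tS _]; apply: homo_ltn => //; exact: lt_trans. Qed.

Lemma timerE (t : nat -> R) k s : jump_times t -> t k <= s < t k.+1 ->
  timer t s = s - t k.
Proof.
move=> tj /andP[ks sk]; rewrite /timer; case: xgetP => [i _ /= /andP[is_ si]|/(_ k)].
  have mono a b : t a <= s -> s < t b -> (a < b)%N.
    move=> ta tb; rewrite ltnNge; apply/negP; rewrite leq_eqVlt => /orP[/eqP ba|ba].
      by move: (le_lt_trans ta tb); rewrite ba ltxx.
    have := lt_trans (le_lt_trans ta tb) (jump_times_lt tj ba).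
    by rewrite ltxx.
  have ik := mono _ _ is_ sk; have ki := mono _ _ ks si.
  by have -> // : i = k; apply/eqP; rewrite eqn_leq; apply/andP.
by move=> /= H; case: H; rewrite ks.
Qed.

Lemma timer_exists (t : nat -> R) s : jump_times t -> t 0%N <= s ->
  exists k, t k <= s < t k.+1.
Proof.
move=> [tS /cvgryPgt/(_ s)[N _ /(_ N (leqnn _)) /= sN]] t0s.
elim: N sN => [|N IH] sN; first by rewrite ltNge t0s in sN.
by case: (ltP s (t N)) => [/IH//|tNs]; exists N; rewrite tNs.
Qed.

(* Feedback on the current state block and the current timer value (at t_k^- the
   timer is the elapsed dwell time) is causal. *)
Lemma timer_state_causal
    (g : 'M[C]_n -> R -> 'M[C]_(m, n)) (h : 'M[C]_n -> R -> 'M[C]_(m, n)) :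
  causal (Policy (fun t x _ s => g (x s) (timer t s))
                 (fun t _ xm k => h (xm k) (t k - t k.-1))).
Proof.
move=> t t' x x' xm xm' tj tj' t0; split => [s t0s tt' _ xx'|k tt' xmE _] /=.
  have [k /andP[ks sk]] := timer_exists tj t0s.
  have kE := tt' _ (or_introl ks).
  have sk' : s < t' k.+1.
    by rewrite ltNge; apply/negP => H; move: sk; rewrite (tt' _ (or_intror H)) ltNge H.
  rewrite xx' ?t0s ?lexx// (timerE tj (k := k)) ?ks// (timerE tj' (k := k)) ?kE//.
  by rewrite -kE ks.
by rewrite xmE// !tt'.
Qed.

End HybridSystems.

Arguments hybrid_system : clear implicits.
Arguments Emx : clear implicits.

(* Main.v *)
Require Import Defs.
From mathcomp Require Import all_boot all_order all_algebra.
From mathcomp Require Import complex.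
From mathcomp Require Import all_classical all_reals all_analysis.
From mathcomp Require Import measurable_realfun lra ring.
Set Implicit Arguments.
Unset Strict Implicit.
Unset Printing Implicit Defensive.
Import Order.TTheory GRing.Theory Num.Theory.
Import numFieldNormedType.Exports.
Local Open Scope classical_set_scope.
Local Open Scope ring_scope.
Local Open Scope complex_scope.
Local Open Scope sesquilinear_scope.

(** The certificate [Ps] is a storage function: with P(tau) = Ps(min(tau, Tmin)),
    the quantity V(s) = <P(tau(s)), X_1(s)> pays for the running cost.

    On flow, V' + <Z, X> = <C_Z, X>. When the Schur complement of a positive
    semidefinite matrix L vanishes and K solves L_3 K + L_2^* = 0, the matrix L
    annihilates the range of [I; K], hence <L, X> = 0 for every X with gain K
    ([mxdot_gain_eq0]). So V' = - <Z, X> for tau < Tmin. Once tau exceeds Tmin, P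
    is frozen, and V' = <F_oo^* (Ps(Tmin)), X> <= - <Z, X> by the stability
    condition and because the pairing of positive semidefinite matrices is
    nonnegative ([mxdotR_psd_ge0]). Since the dwell time is at least Tmin, the value
    of V just before a jump is <Ps(Tmin), X_1>, and the same annihilation applied to
    D_Z shows that the jump lowers V by exactly the jump cost. Integrating over a
    cycle ([cycle_cost]) and telescoping over the cycles ([finite_horizon_cost])
    bounds the cost up to t_N by V(t_0) - V(t_N) <= V(t_0) = <Ps(0), X_1^0>. The
    integrands are nonnegative, so the bound passes to the infinite horizon, which
    dominates every finite one.

    The analytic difficulty is the integration: the state is only absolutely
    continuous, with its equation holding almost everywhere, and the running cost is
    only measurable. The needed inequality is [ac_integral_le]: if V is absolutely
    continuous, g >= 0 is measurable and V' <= - g almost everywhere, then the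
    integral of g over [a, b] is at most V(a) - V(b). It rests on the monotonicity
    of absolutely continuous functions with almost everywhere nonnegative derivative
    ([ac_nondecreasing]), applied to - V minus the primitive of a truncation of
    g. *)

(** * Monotonicity from an almost everywhere derivative *)

Section AbsoluteContinuity.
Context {R : realType}.
Implicit Types (a b : R) (f g : R -> R).
Local Notation mu := (@lebesgue_measure R).

(** Cousin's covering argument in the form of an induction along [a, b]: the
    supremum of the points reached from [a] is reached and, unless it is [b], can be
    passed. *)
Lemma real_induction a b (P : R -> Prop) : a <= b -> P a ->
  (forall x, a <= x <= b -> exists2 d : R, 0 < d &
     forall y z, a <= y -> y <= x -> x <= z -> z <= b ->
       x - d < y -> z < x + d -> P y -> P z) ->
  P b.
Proof.
move=> ab Pa step.
pose S := [set c | [/\ a <= c, c <= b & P c]].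
have Sa : S a by [].
have hS : has_sup S by split; [exists a|exists b => c []].
have ac : a <= sup S by apply: ub_le_sup => //; exact: hS.2.
have cb : sup S <= b by apply: ge_sup => [|c []//]; exists a.
have [|d d0 stepd] := step (sup S); first by rewrite ac.
have [y [ay yb Py] dy] := sup_adherent d0 hS.
have yc : y <= sup S by apply: ub_le_sup => //; exact: hS.2.
have Pz z : sup S <= z -> z <= b -> z < sup S + d -> P z.
  by move=> cz zb zd; exact: (stepd y).
have [cb'|] := ltP (sup S) b; last first.
  by move=> bc; apply: Pz => //; rewrite (le_lt_trans bc)// ltrDl.
pose z := Num.min b (sup S + d / 2).
have cz : sup S < z by rewrite lt_min cb' ltrDl divr_gt0.
have : S z.
  split; [by rewrite (le_trans ac)// ltW|by rewrite ge_min lexx|].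
  apply: Pz; [exact: ltW|by rewrite ge_min lexx|].
  by rewrite gt_min; apply/orP; right; rewrite ltrD2l gtr_pMr// invf_lt1// ltr1n.
move=> /(ub_le_sup hS.2); by rewrite leNgt cz.
Qed.

(** Fix e > 0 and an open set [U] of small measure that contains the exceptional
    points. Moving from [a] to [b] by small steps, a step around a regular point
    loses at most e times its length, while the steps around exceptional points stay
    in [U], so that by absolute continuity their total variation is at most e. *)
Lemma ac_nondecreasing a b f : a <= b -> abs_continuous a b f ->
  {ae mu, forall s, a < s < b -> derivable f s 1 /\ 0 <= derive1 f s} ->
  f a <= f b.
Proof.
move=> ab acf [N0 [mN0 N00 subN0]].
apply/ler_addgt0Pl => e e0.
(* The total loss is [ee * (b - a)] on regular steps plus [ee] on the others. *)
pose ee := e / (b - a + 1).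
have ba1 : 0 < b - a + 1 by rewrite ltr_wpDl// subr_ge0.
have ee0 : 0 < ee by rewrite divr_gt0.
have [d d0 fd] := acf _ ee0.
(* The endpoints, where nothing is known of the derivative, are exceptional. *)
pose N := N0 `|` [set a] `|` [set b].
have mN : measurable N by do 2 apply: measurableU => //.
have N0E : mu N = 0%E.
  have mN0a : measurable (N0 `|` [set a]) by exact: measurableU.
  apply/eqP; rewrite eq_le measure_ge0 andbT.
  apply: le_trans (measureU2 mu mN0a (measurable_set1 b)) _.
  rewrite [X in (_ + X <= _)%E](_ : _ = 0%E); last exact: lebesgue_measure_set1.
  rewrite adde0; apply: le_trans (measureU2 mu mN0 (measurable_set1 a)) _.
  rewrite [X in (_ + X <= _)%E](_ : _ = 0%E); last exact: lebesgue_measure_set1.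
  by rewrite [X in (X + _ <= _)%E](_ : _ = 0%E)// adde0.
have [|U [oU NU UN]] := lebesgue_regularity_outer mN _ d0.
  by rewrite [ltLHS](_ : _ = 0%E)// ltry.
have mU : measurable U by exact: open_measurable.
have Ud : (mu U < d%:E)%E.
  have -> : U = N `|` (U `\` N) by rewrite setDUK.
  apply: le_lt_trans (measureU2 mu mN (measurableD mU mN)) _.
  by rewrite [X in (X + _ < _)%E](_ : _ = 0%E)// add0e.
have mUi c : measurable (U `&` `[a, c]) by exact: measurableI.
(* [s] lists the steps made so far around exceptional points; bounding its length by
   the measure of [U] below [c] makes the bound additive when a step is appended. *)
pose P c := exists s : seq (R * R),
  [/\ all (fun I => [&& a <= I.1, I.1 <= I.2 & I.2 <= c]) s,
      pairwise (fun I J => (I.2 <= J.1) || (J.2 <= I.1)) s,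
      ((\sum_(I <- s) (I.2 - I.1))%:E <= mu (U `&` `[a, c]))%E &
      f a <= f c + ee * (c - a) + \sum_(I <- s) `|f I.2 - f I.1|].
have : P b.
  apply: (@real_induction a b) => //.
    exists [::]; split => //; rewrite !big_nil ?measure_ge0//.
    by rewrite subrr mulr0 !addr0.
  move=> x /andP[ax xb].
  have [xN|xN] := pselect (N x).
    have [r r0 rU] : exists2 r : R, 0 < r & ball x r `<=` U.
      have /= := oU _ (NU _ xN).
      by move/nbhs_ballP => [r /= r0 rU]; exists r.
    exists r => // y z ay yx xz zb xy zx [s [s1 s2 s3 s4]].
    have yz := le_trans yx xz.
    exists ((y, z) :: s); split.
    - rewrite /= ay yz lexx/=; apply/allP => I /(allP s1)/and3P[-> -> /=].
      by move=> /le_trans; apply.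
    - rewrite /= s2 andbT; apply/allP => I /(allP s1)/and3P[_ _ /= ->].
      by rewrite orbT.
    - rewrite big_cons/= EFinD.
      have <- : mu `]y, z] = (z - y)%:E.
        by rewrite lebesgue_measure_itv/= lte_fin; case: ltgtP yz => // ->; rewrite subrr.
      apply: (@le_trans _ _ (mu (`]y, z] `|` (U `&` `[a, y])))).
        rewrite [leRHS](_ : _ = mu `]y, z] + mu (U `&` `[a, y]))%E ?leeD//.
        apply: measureU; [exact: measurable_itv|exact: mUi|].
        rewrite -subset0 => w [] /=; rewrite !in_itv/= => /andP[yw _] [_ /andP[_]].
        by rewrite leNgt yw.
      apply: le_measure; rewrite ?inE.
      + by apply: measurableU; [exact: measurable_itv|exact: mUi].
      + exact: mUi.
      move=> w [|] /=; rewrite !in_itv/=.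
        move=> /andP[yw wz]; split; last by rewrite wz (le_trans ay)// ltW.
        by apply: rU; rewrite /ball/= ltr_distlC (lt_trans xy yw) (le_lt_trans wz zx).
      by move=> [Uw /andP[-> wy]]; rewrite (le_trans wy yz).
    - rewrite big_cons/=; apply: le_trans s4 _.
      have : f y - f z <= `|f z - f y| by rewrite distrC ler_norm.
      have : ee * (y - a) <= ee * (z - a) by rewrite ler_pM2l// lerB.
      lra.
  have {xb ax}/andP[ax xb] : a < x < b.
    rewrite !lt_neqAle ax xb !andbT; apply/andP; split.
      by apply/eqP => /esym xa; apply: xN; left; right.
    by apply/eqP => xE; apply: xN; right.
  have [dfx f'x] : derivable f x 1 /\ 0 <= derive1 f x.
    have [//|h] := pselect (derivable f x 1 /\ 0 <= derive1 f x).
    exfalso; apply: xN; left; left; apply: subN0 => /= H; apply: h.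
    by apply: H; rewrite ax.
  have [r r0 fr] : exists2 r : R, 0 < r & forall h, h != 0 -> `|h| < r ->
      - ee < h^-1 * (f (h + x) - f x).
    have /cvgrPdist_lt/(_ _ ee0)[r /= r0 H] := dfx.
    exists r => // h h0 hr.
    have := H h; rewrite /= sub0r normrN => /(_ hr h0).
    rewrite -[lim _]/('D_1 f x) -derive1E ltr_norml => /andP[_].
    rewrite -[_ *: _]/(_ * _) [h *: _]mulr1; lra.
  exists r => // y z ay yx xz zb xy zx [s [s1 s2 s3 s4]].
  have yz := le_trans yx xz.
  exists s; split => //.
  - apply/allP => I /(allP s1)/and3P[-> -> /=].
    by move=> /le_trans; apply.
  - apply: le_trans s3 _; apply: le_measure; rewrite ?inE; [exact: mUi|exact: mUi|].
    by apply: setIS; apply: subset_itvl; rewrite bnd_simp.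
  - apply: le_trans s4 _; rewrite lerD2r.
    have fz : f x <= f z + ee * (z - x).
      have [->|zx0] := eqVneq z x; first by rewrite subrr mulr0 addr0.
      have h0 : 0 < z - x by rewrite subr_gt0 lt_neqAle eq_sym zx0.
      have := fr (z - x); rewrite gt_eqF// gtr0_norm// subrK => /(_ isT).
      rewrite ltrBlDl => /(_ zx); rewrite mulrC ltr_pdivlMr//; lra.
    have fy : f y <= f x + ee * (x - y).
      have [->|yx0] := eqVneq y x; first by rewrite subrr mulr0 addr0.
      have h0 : y - x < 0 by rewrite subr_lt0 lt_neqAle yx0.
      have := fr (y - x); rewrite lt_eqF// ltr0_norm// opprB subrK => /(_ isT).
      rewrite ltrBlDl -ltrBlDr => /(_ xy); rewrite mulrC ltr_ndivlMr//; lra.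
    lra.
move=> [s [s1 s2 s3 s4]].
have : \sum_(I <- s) (I.2 - I.1) < d.
  rewrite -lte_fin; apply: le_lt_trans s3 (le_lt_trans _ Ud).
  by apply: le_measure; rewrite ?inE; [exact: mUi|exact: mU|exact: subIsetl].
move=> /(fd s s1 s2) sm.
have eE : ee * (b - a) + ee = e by rewrite -[X in _ + X]mulr1 -mulrDr divfK ?gt_eqF.
lra.
Qed.
End AbsoluteContinuity.

(** * Operations on absolutely continuous functions, integration *)

Section AbsoluteContinuityClosure.
Context {R : realType}.
Implicit Types (a b k : R) (f g h : R -> R).
Local Notation mu := (@lebesgue_measure R).

(** Common source of the closure properties: a function whose increments are
    controlled by those of two absolutely continuous functions. *)
Lemma ac_dominated a b k f g h : 0 < k ->
  abs_continuous a b f -> abs_continuous a b g ->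
  (forall x y, a <= x -> x <= y -> y <= b ->
     `|h y - h x| <= k * (`|f y - f x| + `|g y - g x|)) ->
  abs_continuous a b h.
Proof.
move=> k0 acf acg hfg e e0.
have e2 : 0 < e / k / 2 by rewrite !divr_gt0.
have [d1 d10 fd] := acf _ e2; have [d2 d20 gd] := acg _ e2.
exists (Num.min d1 d2) => [|s s1 s2]; first by rewrite lt_min d10.
rewrite lt_min => /andP[/(fd _ s1 s2) fs /(gd _ s1 s2) gs].
apply: (@le_lt_trans _ _ (\sum_(I <- s) k * (`|f I.2 - f I.1| + `|g I.2 - g I.1|))).
  rewrite big_seq [leRHS]big_seq; apply: ler_sum => I /(allP s1)/and3P[? ? ?].
  exact: hfg.
rewrite -mulr_sumr big_split/= mulrC -ltr_pdivlMr//.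
lra.
Qed.

Lemma ac_id a b : abs_continuous a b id.
Proof.
move=> e e0; exists e => // s s1 _ /(le_lt_trans _); apply.
rewrite big_seq [leRHS]big_seq; apply: ler_sum => I /(allP s1)/and3P[_ ? _].
by rewrite ger0_norm// subr_ge0.
Qed.

Lemma ac_lipschitz a b k f :
  (forall x y, a <= x -> x <= y -> y <= b -> `|f y - f x| <= k * (y - x)) ->
  abs_continuous a b f.
Proof.
move=> fk; apply: (@ac_dominated a b (`|k| + 1) id id); [|exact: ac_id|exact: ac_id|].
  by rewrite ltr_wpDl.
move=> x y ax xy yb; apply: le_trans (fk _ _ ax xy yb) _.
have := ler_norm k; have : 0 <= `|k| by [].
rewrite (ger0_norm (_ : 0 <= y - x)) ?subr_ge0//.
have : 0 <= y - x by rewrite subr_ge0.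
nra.
Qed.

Lemma ac_bounded a b f : abs_continuous a b f -> a <= b ->
  exists M, forall x, a <= x <= b -> `|f x| <= M.
Proof.
move=> acf ab; have [d d0 fd] := acf _ ltr01.
have f1 x y : a <= x -> x <= y -> y <= b -> y < x + d -> `|f y - f x| < 1.
  move=> ax xy yb yxd; have := fd [:: (x, y)]; rewrite !big_seq1/= ax xy yb.
  by apply=> //; rewrite ltrBlDl.
apply: (@real_induction _ a b
  (fun c => exists M, forall x, a <= x <= c -> `|f x| <= M)) => //.
  by exists `|f a| => x /le_anti ->.
move=> x _; exists (d / 2) => [|y z ay yx xz zb xy zx [M fM]]; first by rewrite divr_gt0.
exists (M + 1) => w /andP[aw wz].
have [wy|yw] := leP w y; first by rewrite ler_wpDr// fM// aw.
have : `|f w - f y| < 1.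
  apply: f1 => //; [exact: ltW|exact: le_trans zb|lra].
have : `|f y| <= M by rewrite fM// ay/=.
have := ler_normD (f w - f y) (f y); rewrite subrK; lra.
Qed.

Lemma ac_add a b f g : abs_continuous a b f -> abs_continuous a b g ->
  abs_continuous a b (fun x => f x + g x).
Proof.
move=> acf acg; apply: (ac_dominated ltr01 acf acg) => x y _ _ _.
by rewrite mul1r opprD addrACA ler_normD.
Qed.

Lemma ac_opp a b f : abs_continuous a b f -> abs_continuous a b (fun x => - f x).
Proof.
move=> acf; apply: (ac_dominated ltr01 acf acf) => x y _ _ _.
by rewrite mul1r -opprD normrN lerDl.
Qed.

Lemma ac_mul a b f g : a <= b -> abs_continuous a b f -> abs_continuous a b g ->
  abs_continuous a b (fun x => f x * g x).
Proof.
move=> ab acf acg.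
have [M fM] := ac_bounded acf ab; have [N gN] := ac_bounded acg ab.
have M0 : 0 <= M by apply: le_trans (fM a _); rewrite ?lexx.
have N0 : 0 <= N by apply: le_trans (gN a _); rewrite ?lexx.
apply: (ac_dominated (_ : 0 < M + N + 1) acf acg) => [|x y ax xy yb]; first by lra.
have -> : f y * g y - f x * g x = f y * (g y - g x) + (f y - f x) * g x by ring.
have fy : `|f y| <= M by rewrite fM// (le_trans ax).
have gx : `|g x| <= N by rewrite gN// ax (le_trans xy).
apply: le_trans (ler_normD _ _) _; rewrite !normrM.
have : 0 <= `|g y - g x| by []. have : 0 <= `|f y - f x| by []. nra.
Qed.

Lemma ac_sum a b (I : Type) (r : seq I) (F : I -> R -> R) :
  (forall i, abs_continuous a b (F i)) ->
  abs_continuous a b (fun x => \sum_(i <- r) F i x).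
Proof.
move=> acF; elim: r => [|i r IH].
  apply: (@ac_lipschitz a b 0) => x y _ _ _.
  by rewrite !big_nil subrr normr0 mul0r.
rewrite (_ : (fun _ => _) = fun x => F i x + \sum_(j <- r) F j x); last first.
  by apply/funext => x; rewrite big_cons.
exact: ac_add.
Qed.

(** Each truncation of [g] is bounded, so its primitive [F] is Lipschitz and, by
    Lebesgue's differentiation theorem, has it as derivative almost everywhere; then
    - V - F is absolutely continuous with nonnegative derivative, hence
    nondecreasing. Monotone convergence removes the truncation. In particular [g] turns
    out to be integrable. *)
Lemma ac_integral_le a b V g : a <= b -> abs_continuous a b V ->
  measurable_fun `[a, b] g -> (forall s, a <= s <= b -> 0 <= g s) ->
  {ae mu, forall s, a < s < b -> derivable V s 1 /\ derive1 V s <= - g s} ->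
  (\int[mu]_(s in `[a, b]) (g s)%:E <= (V a - V b)%:E)%E.
Proof.
move=> ab acV mg g0 V'g.
have trunc (n : nat) :
    (\int[mu]_(s in `[a, b]) (Num.min (g s) n%:R)%:E <= (V a - V b)%:E)%E.
  pose h0 s := Num.min (g s) n%:R.
  have mh0 : measurable_fun `[a, b] h0 by exact: measurable_minr.
  have h0_ge0 s : a <= s <= b -> 0 <= h0 s.
    by move=> sab; rewrite le_min ler0n g0.
  have h0_le s : h0 s <= n%:R by rewrite ge_min lexx orbT.
  have ih0 : mu.-integrable `[a, b] (EFin \o h0).
    apply: measurable_bounded_integrable => //.
      by rewrite [ltLHS](lebesgue_measure_itv _); case: ifP; rewrite ltry.
    exists n%:R; split=> // M nM s /= sab.
    by rewrite ger0_norm ?h0_ge0// (le_trans (h0_le s))// ltW.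
  pose h := h0 \_ `[a, b].
  have hE s : a <= s <= b -> h s = h0 s.
    by move=> sab; rewrite /h patchE mem_set.
  have loch : locally_integrable setT h by exact: integrable_locally_restrict.
  have ih (A : set R) : measurable A -> mu.-integrable A (EFin \o h).
    move=> mA; apply: (@integrableS _ _ _ _ setT) => //.
    by rewrite /h -restrict_EFin; apply/(integrable_mkcond _ _).1.
  pose F x := (\int[mu]_(t in [set` Interval (BLeft a) (BRight x)]) h t)%R.
  have FB x y : a <= x -> x <= y -> F y - F x = (\int[mu]_(t in `]x, y]) h t)%R.
    move=> ax xy; rewrite /F (@Rintegral_itvB _ h)//.
    exact: ih.
  have Fa : F a = 0 by rewrite /F set_itv1 Rintegral_set1.
  have h_ge0 s : 0 <= h s.
    rewrite /h patchE; case: ifPn => // /set_mem /=; rewrite in_itv/=; exact: h0_ge0.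
  have h_le s : h s <= n%:R.
    by rewrite /h patchE; case: ifPn.
  have acF : abs_continuous a b F.
    apply: (@ac_lipschitz a b n%:R) => x y ax xy yb.
    rewrite FB// ger0_norm ?Rintegral_ge0//.
    have -> : n%:R * (y - x) = (\int[mu]_(t in `]x, y]) (n%:R : R))%R.
      rewrite Rintegral_cst//= [X in fine X](lebesgue_measure_itv _)/= lte_fin.
      by case: ltgtP xy => // ->; rewrite subrr mulr0.
    apply: le_Rintegral => //; first exact: ih.
    apply: measurable_bounded_integrable => //.
      by rewrite [ltLHS](lebesgue_measure_itv _); case: ifP; rewrite ltry.
    exact: bounded_cst.
  have F' : {ae mu, forall x, a < x -> derivable F x 1 /\ derive1 F x = h x}.
    apply: (FTC1 (a := BLeft a)) => // y; exact: ih.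
  have WF : - V a + - F a <= - V b + - F b.
    apply: (@ac_nondecreasing _ a b (fun x => - V x + - F x)) => //.
      by apply: ac_add; exact: ac_opp.
    move: V'g F'; apply: filterS2; first exact: (ae_filter_ringOfSetsType mu).
    move=> s Vs Fs sab.
    have [dV V's] := Vs sab; have /Fs[dF F's] : a < s by case/andP: sab.
    split; first by apply: derivableD; exact: derivableN.
    rewrite derive1E deriveD; [|exact: derivableN|exact: derivableN].
    rewrite !deriveN// -!derive1E F's hE; last by case/andP: sab => /ltW-> /ltW->.
    have : h0 s <= g s by rewrite ge_min lexx.
    lra.
  rewrite (_ : integral _ _ _ = (F b)%:E); last first.
    rewrite /F /Rintegral fineK; last by apply: integrable_fin_num => //; exact: ih.
    apply: eq_integral => s /set_mem /=; rewrite in_itv/= => sab.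
    by rewrite hE.
  rewrite lee_fin; lra.
pose G n s := (Num.min (g s) n%:R)%:E.
have : (\int[mu]_(s in `[a, b]) G n s)%E @[n --> \oo] -->
    (\int[mu]_(s in `[a, b]) limn (G^~ s))%E.
  apply: cvg_monotone_convergence => //.
  - by move=> n; apply/measurable_EFinP; exact: measurable_minr.
  - by move=> n s /= sab; rewrite lee_fin le_min ler0n g0.
  - move=> s _ n m nm; rewrite lee_fin le_min ge_min lexx/= ge_min.
    by rewrite ler_nat nm orbT.
rewrite [X in _ --> X](_ : _ = \int[mu]_(s in `[a, b]) (g s)%:E)%E; last first.
  apply: eq_integral => s _; apply/cvg_lim => //.
  apply: cvg_EFin; first exact: nearW.
  apply: cvg_near_cst; near=> n; apply/min_idPl; near: n; exact: nbhs_infty_ger.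
move=> Gcvg; rewrite -(cvg_lim _ Gcvg)//; apply: lime_le.
  by apply/cvg_ex; eexists; exact: Gcvg.
exact: nearW.
Unshelve. all: by end_near. Qed.

End AbsoluteContinuityClosure.

Section HalfOpen.
Context {R : realType}.
Implicit Types (a b c k l : R) (f g V : R -> R).
Local Notation mu := (@lebesgue_measure R).

(** Version for a function that is controlled only strictly before [c], such as the
    energy before a jump, where only a left limit is available. *)
Lemma ac_integral_left_limit_le a c V g l : a < c ->
  (forall b, a <= b < c -> abs_continuous a b V) ->
  measurable_fun `[a, c[ g -> (forall s, a <= s < c -> 0 <= g s) ->
  (forall b, a <= b < c ->
     {ae mu, forall s, a < s < b -> derivable V s 1 /\ derive1 V s <= - g s}) ->
  V s @[s --> c^'-] --> l ->
  (\int[mu]_(s in `[a, c[) (g s)%:E <= (V a - l)%:E)%E.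
Proof.
move=> ac acV mg g0 V'g Vl.
pose b n := c - (c - a) / n.+1%:R.
have ca : 0 < c - a by rewrite subr_gt0.
have bE n : a <= b n < c.
  rewrite /b ltrBlDr ltrDl divr_gt0// andbT lerBrDr -lerBrDl.
  by rewrite ler_pdivrMr// ler_peMr ?ler1n// ltW.
have bc : b n @[n --> \oo] --> c.
  rewrite -[X in _ --> X](subr0 c); apply: cvgB; first exact: cvg_cst.
  rewrite -(mulr0 (c - a)); apply: cvgM; [exact: cvg_cst|exact: cvg_harmonic].
have Eb : \bigcup_n (`[a, b n]%classic) = `[a, c[%classic.
  apply/seteqP; split => s /=.
    move=> [n _] /=; rewrite !in_itv/= => /andP[-> /le_lt_trans]; apply.
    by case/andP: (bE n).
  rewrite in_itv/= => /andP[as_ sc].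
  have [N _ /(_ N (leqnn N))/= sN] := cvgr_gt _ bc _ sc.
  by exists N => //=; rewrite in_itv/= as_ ltW.
have nnd : {homo (fun n => `[a, b n]%classic) : n m / (n <= m)%N >-> (n <= m)%O}.
  move=> n m nm; apply/subsetPset/subset_itvl; rewrite bnd_simp.
  by rewrite lerB// ler_pM2l// lef_pV2 ?posrE// ler_nat.
have sub n s : s \in `[a, b n] -> a <= s < c.
  by rewrite in_itv/= => /andP[-> /le_lt_trans]; apply; case/andP: (bE n).
have mgn n : measurable_fun `[a, b n] (EFin \o g).
  by apply/measurable_EFinP; apply: measurable_funS mg => // s /= /sub; rewrite in_itv.
have := @ge0_nondecreasing_set_cvg_integral _ (measurableTypeR R) R _ (EFin \o g) mu nnd
  (fun=> measurable_itv _) mgn (fun n s sb => g0 s (sub n s sb)).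
rewrite Eb => Icvg.
have Vcvg : (V a - V (b n))%:E @[n --> \oo] --> (V a - l)%:E.
  apply: cvg_EFin; first exact: nearW.
  apply: cvgB; first exact: cvg_cst.
  move/cvg_at_leftP: Vl; apply; split => // n; by case/andP: (bE n).
rewrite -(cvg_lim _ Icvg)// -(cvg_lim _ Vcvg)//; apply: lee_lim.
- by apply/cvg_ex; eexists; exact: Icvg.
- by apply/cvg_ex; eexists; exact: Vcvg.
apply: nearW => n; case/andP: (bE n) => abn bnc.
apply: ac_integral_le => //.
- by apply: acV; rewrite abn.
- apply: measurable_funS mg => // s /=.
  by rewrite !in_itv/= => /andP[-> /le_lt_trans]; apply.
- by move=> s /andP[as_ sb]; rewrite g0// as_/= (le_lt_trans sb).
- by apply: V'g; rewrite abn.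
Qed.

(** The extension of the derivative to the closed interval is bounded, and the mean
    value theorem turns its bound into a Lipschitz constant. *)
Lemma C1_lipschitz a b f : a <= b -> {within `[a, b], continuous f} ->
  C1_on a b f ->
  exists2 k, 0 <= k & forall x y, a <= x -> x <= y -> y <= b ->
    `|f y - f x| <= k * (y - x).
Proof.
move=> ab cf [g [cg fg]].
have [u _ ug] := EVT_max ab cg; have [v _ vg] := EVT_min ab cg.
exists (`|g u| + `|g v|) => [|x y ax xy yb]; first exact: addr_ge0.
have [->|xy'] := eqVneq x y; first by rewrite !subrr normr0 mulr0.
have {}xy : x < y by rewrite lt_neqAle xy'.
have [||z] := @MVT R f g x y xy.
- by move=> z; rewrite in_itv/= => /andP[xz zy]; apply: fg;
    rewrite (le_lt_trans ax) ?(lt_le_trans zy).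
- apply: continuous_subspaceW cf => z /=; rewrite !in_itv/= => /andP[xz zy].
  by rewrite (le_trans ax)// (le_trans zy).
rewrite in_itv/= => /andP[xz zy] ->.
rewrite normrM (gtr0_norm (_ : 0 < y - x)) ?subr_gt0//.
rewrite ler_wpM2r ?subr_ge0 ?(ltW xy)//.
have zab : z \in `[a, b] by rewrite in_itv/= (le_trans ax (ltW xz)) (le_trans (ltW zy)).
have := ug _ zab; have := vg _ zab.
have := ler_norm (g u); have := ler_norm (- g v); rewrite normrN.
have : 0 <= `|g u| by []. have : 0 <= `|g v| by [].
by move=> *; rewrite ler_norml; apply/andP; split; lra.
Qed.

Lemma piecewise_C1_lipschitz a b f : piecewise_C1 a b f ->
  (exists2 k, 0 <= k & forall x y, a <= x -> x <= y -> y <= b ->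
     `|f y - f x| <= k * (y - x)) /\
  exists s : seq R, forall x, a < x < b -> x \notin s -> derivable f x 1.
Proof.
move=> [cf [s [ps sb C1]]]; rewrite -{b}sb in cf *.
elim: s a cf ps C1 => [|c s IH] a /=.
  move=> _ _ _; split; [exists 0|exists [::]] => //.
    move=> x y ax xy ya; have -> : x = y.
      by apply/le_anti; rewrite xy (le_trans ya).
    by rewrite subrr normr0 mul0r.
  by move=> x /andP[ax /(lt_trans ax)]; rewrite ltxx.
move=> cf /andP[ac pcs] C1.
have cl : c <= last c s.
  elim: (s) (c) pcs => [|e r IHr] c0 //= /andP[c0e /IHr]; exact: le_trans (ltW _).
have [||[k1 k10 fk1] [r fr]] := IH c _ pcs.
- apply: continuous_subspaceW cf => z /=; rewrite !in_itv/= => /andP[cz ->].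
  by rewrite andbT (le_trans (ltW ac)).
- by move=> i si; exact: (C1 i.+1).
have C1a : C1_on a c f by exact: (C1 0%N).
have [|k2 k20 fk2] := C1_lipschitz (ltW ac) _ C1a.
  apply: continuous_subspaceW cf => z /=; rewrite !in_itv/= => /andP[-> zc].
  by rewrite (le_trans zc).
split.
  exists (k1 + k2) => [|x y ax xy yl]; first exact: addr_ge0.
  have [cx|xc] := leP c x.
    apply: le_trans (fk1 _ _ cx xy yl) _; nra.
  have [yc|cy] := leP y c.
    apply: le_trans (fk2 _ _ ax xy yc) _; nra.
  have := fk1 _ _ (lexx c) (ltW cy) yl; have := fk2 _ _ ax (ltW xc) (lexx c).
  have := ler_normD (f y - f c) (f c - f x); rewrite subrKA; nra.
exists (c :: r) => x /andP[ax xl]; rewrite inE negb_or => /andP[xc xr].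
have [xc'|cx] := ltP x c.
  case: C1a => g [_ /(_ x)]; rewrite ax xc' => /(_ isT) dfx.
  exact: ex_derive.
by apply: fr => //; rewrite xl andbT lt_neqAle eq_sym xc.
Qed.

End HalfOpen.

(** * The pairing of Hermitian matrices *)

Section Hermitian.
Context {R : realType}.
Local Notation C := R[i].

Lemma hermsymmx_ctrmx p (A : 'M[C]_p) : (A \is hermsymmx) <-> A^t* = A.
Proof.
split=> [/is_hermitianmxP|] AE; last first.
  by apply/is_hermitianmxP; rewrite expr0 scale1r AE.
by rewrite [RHS]AE expr0 scale1r.
Qed.

Lemma ReD (x y : C) : complex.Re (x + y) = complex.Re x + complex.Re y.
Proof. by case: x y => [a b] [c d]. Qed.

Lemma ReN (x : C) : complex.Re (- x) = - complex.Re x.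
Proof. by case: x. Qed.

Lemma ReM_conj (x y : C) :
  complex.Re (x * y^*) = complex.Re x * complex.Re y + complex.Im x * complex.Im y.
Proof. by case: x y => [a b] [c d] /=; rewrite mulrN opprK. Qed.

Lemma mxdotR_sum p q (A B : 'M[C]_(p, q)) : mxdotR A B =
  \sum_i \sum_j (complex.Re (A i j) * complex.Re (B i j) +
                 complex.Im (A i j) * complex.Im (B i j)).
Proof.
rewrite /mxdotR /mxdot /mxtrace (big_morph _ ReD (erefl _)).
apply: eq_bigr => i _; rewrite mxE (big_morph _ ReD (erefl _)).
by apply: eq_bigr => j _; rewrite -ReM_conj !mxE.
Qed.

Lemma mxdotRDl p q (A B D : 'M[C]_(p, q)) :
  mxdotR (A + B) D = mxdotR A D + mxdotR B D.
Proof. by rewrite /mxdotR /mxdot mulmxDl mxtraceD ReD. Qed.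

Lemma mxdotRNl p q (A D : 'M[C]_(p, q)) : mxdotR (- A) D = - mxdotR A D.
Proof. by rewrite /mxdotR /mxdot mulNmx raddfN ReN. Qed.

(** Diagonalising [B] in an orthonormal basis writes <A, B> as a sum of products of
    values of the quadratic forms of [A] and [B] on the basis vectors. *)
Lemma mxdotR_psd_ge0 p (A B : 'M[C]_p) : psdmx A -> psdmx B -> 0 <= mxdotR A B.
Proof.
move=> [_ A0] [hB B0].
have Bt : B^t* = B by apply/hermsymmx_ctrmx.
have := hermitian_normalmx hB => /orthomx_spectralP.
set U := spectralmx B; set d := spectral_diag B => BE.
have uU : U \is unitarymx by exact: spectral_unitarymx.
rewrite invmx_unitary// in BE.
have UU : U *m U^t* = 1%:M by apply/unitarymxP.
have dE : diag_mx d = U *m B *m U^t*.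
  by rewrite BE !mulmxA UU mul1mx -mulmxA UU mulmx1.
have quad (M : 'M[C]_p) i : (U *m M *m U^t*) i i =
    (((row i U)^t*)^t* *m M *m (row i U)^t*) 0 0.
  by rewrite ctrmxK -row_mul [LHS]mxE [RHS]mxE; apply: eq_bigr => k _; rewrite !mxE.
have : 0 <= mxdot A B.
  rewrite /mxdot Bt BE !mulmxA mxtrace_mulC !mulmxA mul_mx_diag /mxtrace.
  apply: sumr_ge0 => i _; rewrite mxE; apply: mulr_ge0; first by rewrite quad.
  have -> : d 0 i = diag_mx d i i by rewrite mxE eqxx mulr1n.
  by rewrite dE quad.
by rewrite lecE => /andP[].
Qed.

End Hermitian.

Section Gains.
Context {R : realType} {n m : nat}.
Local Notation C := R[i].
Implicit Types (L X : 'M[C]_(n + m)) (P : 'M[C]_n) (K : 'M[C]_(m, n)).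

Lemma state_ulsubmx X : state X = ulsubmx X.
Proof.
rewrite /state /Emx tr_row_mx map_col_mx trmx1 trmx0 map_mx1 map_mx0.
rewrite -[X in LHS]submxK mul_row_block !mul1mx !mul0mx !addr0.
by rewrite mul_row_col mulmx1 mulmx0 addr0.
Qed.

Lemma mxdot_state P X : mxdot P (state X) = mxdot ((Emx R n m)^t* *m P *m Emx R n m) X.
Proof. by rewrite /mxdot /state !ctrmxM ctrmxK !mulmxA mxtrace_mulC !mulmxA. Qed.

(** Why the gains are optimal. If L_3 K = - L_2^* then L_2 K = - K^* L_3 K, and
    L_2 L_3^+ L_2^* = K^* L_3 L_3^+ L_3 K = K^* L_3 K, so that L_1 + L_2 K is the
    Schur complement, which vanishes. Hence L [I; K] = 0, whereas X is
    [I; K] X_1 [I; K]^*. *)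
Lemma mxdot_gain_eq0 L K X : L \is hermsymmx -> schur L = 0 -> gain_set L K ->
  X \is hermsymmx -> uses_gain K X -> mxdot L X = 0.
Proof.
move=> /hermsymmx_ctrmx hL sL LK hX [X2 X3].
have Xt : X^t* = X by apply/hermsymmx_ctrmx.
rewrite state_ulsubmx in X2 X3.
have [L2 L3] : dlsubmx L = (ursubmx L)^t* /\ (drsubmx L)^t* = drsubmx L.
  split; first by rewrite -{1}hL -map_trmx; apply/matrixP => i j; rewrite !mxE.
  by rewrite -{2}hL; apply/matrixP => i j; rewrite !mxE.
have [X1t X2t] : (ulsubmx X)^t* = ulsubmx X /\ ursubmx X = (dlsubmx X)^t*.
  by split; [rewrite -{2}Xt|rewrite -{1}Xt]; apply/matrixP => i j; rewrite !mxE.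
have /eqP := LK; rewrite addrC addr_eq0 => /eqP L2E.
have L2E' : ursubmx L = - (K^t* *m drsubmx L).
  rewrite -(ctrmxK (ursubmx L)) L2E -{2}L3 -ctrmxM.
  by apply/matrixP => i j; rewrite !mxE rmorphN.
have [LGL _ _ _] := mpinvP (drsubmx L).
have L1E : ulsubmx L = K^t* *m drsubmx L *m K.
  apply/eqP; rewrite -subr_eq0 -[X in _ == X]sL /schur L2E L2E'; apply/eqP.
  congr (_ - _); rewrite !mulNmx mulmxN opprK.
  by rewrite -[in LHS]LGL !mulmxA.
rewrite /mxdot Xt -[L in LHS]submxK -[X in LHS]submxK mulmx_block mxtrace_block.
rewrite X2t X3 X2 L2 L2E L2E' L1E ctrmxM X1t !mulmxA !mulNmx -mulmxA.
by rewrite !mulmxA !subrr addNr !linear0 addr0.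
Qed.

End Gains.

(** * The certificate along a cycle *)

Section Clamp.
Context {R : realType}.
Implicit Types (f : R -> R) (T b c : R).
Local Notation mu := (@lebesgue_measure R).

(** A function of the timer started at [t0], frozen once the timer reaches [T]. A
    single Lipschitz function thus serves for the whole of a cycle, whatever its
    length. *)
Definition clamped {A : Type} (f : R -> A) t0 T (s : R) : A := f (Num.min (s - t0) T).

Lemma clamped_lipschitz f T k t0 x y : 0 <= T -> 0 <= k ->
  (forall x y, 0 <= x -> x <= y -> y <= T -> `|f y - f x| <= k * (y - x)) ->
  t0 <= x -> x <= y -> `|clamped f t0 T y - clamped f t0 T x| <= k * (y - x).
Proof.
move=> T0 k0 fk tx xy; apply: le_trans (fk _ _ _ _ _) _.
- by rewrite le_min T0 subr_ge0 tx.
- by rewrite le_min !ge_min lexx orbT lerB.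
- by rewrite ge_min lexx orbT.
rewrite ler_wpM2l// lerBlDr ge_min.
have [xT|Tx] := leP (x - t0) T; first by apply/orP; left; lra.
by apply/orP; right; lra.
Qed.

Lemma clamped_ac f T t0 b : 0 <= T -> piecewise_C1 0 T f ->
  abs_continuous t0 b (clamped f t0 T).
Proof.
move=> T0 /piecewise_C1_lipschitz[[k k0 fk] _].
apply: (@ac_lipschitz _ t0 b k) => x y tx xy _; exact: clamped_lipschitz.
Qed.

(** A cycle that ends at [c] lasts at least [T], hence the value just before the jump
    does not depend on its length; when it lasts exactly [T] this is the
    continuity of [f] at [T]. *)
Lemma clamped_left_limit f T t0 c : 0 < T -> t0 + T <= c -> piecewise_C1 0 T f ->
  clamped f t0 T s @[s --> c^'-] --> f T.
Proof.
move=> T0 Tc /piecewise_C1_lipschitz[[k k0 fk] _].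
have fc : f T = clamped f t0 T c.
  by rewrite /clamped (_ : Num.min _ _ = T)//; apply/min_idPr; lra.
rewrite fc; apply/cvgrPdist_le => e e0.
have k1 : 0 < k + 1 by lra.
near=> s.
have sc : s < c by near: s; exact: nbhs_left_lt.
have ts : t0 <= s by near: s; apply: nbhs_left_ge; lra.
apply: le_trans (clamped_lipschitz (ltW T0) k0 fk ts (ltW sc)) _.
have : c - s < e / (k + 1).
  rewrite ltrBlDr -ltrBlDl; near: s; apply: nbhs_left_gt.
  by rewrite ltrBlDr ltrDl divr_gt0.
rewrite ltr_pdivlMr// => H.
by apply: le_trans (ltW H); rewrite mulrC ler_wpM2l ?subr_ge0 ?(ltW sc)// lerDl.
Unshelve. all: by end_near. Qed.

Lemma ae_notin_seq (r : seq R) : {ae mu, forall s, s \notin r}.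
Proof.
elim: r => [|x r IH]; first exact: aeW.
have nx : {ae mu, forall s, s != x}.
  exists [set x]; split => [//||s /= /negP]; first exact: lebesgue_measure_set1.
  by rewrite negbK => /eqP.
move: nx IH; apply: filterS2; first exact: (ae_filter_ringOfSetsType mu).
by move=> s sx sr; rewrite inE negb_or sx.
Qed.

Lemma clamped_derive f T t0 s : derivable f (s - t0) 1 -> s < t0 + T ->
  derivable (clamped f t0 T) s 1 /\
  derive1 (clamped f t0 T) s = derive1 f (s - t0).
Proof.
move=> df sT.
have dc : is_derive s 1 (clamped f t0 T) (derive1 f (s - t0)).
  apply: (@near_eq_is_derive _ _ _ (f \o shift (- t0))).
    near=> z; rewrite /clamped /= /shift/=; congr f; apply/esym/min_idPl.
    by rewrite lerBlDl; apply: ltW; near: z; exact: lt_nbhsl.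
  have := is_derive_shift s (1 : R) (- t0).
  have df' : is_derive (shift (- t0) s) 1 f (derive1 f (s - t0)).
    by rewrite derive1E; exact: derivableP.
  by move=> /(is_derive1_comp df'); rewrite mulr1.
by split; [exact: ex_derive|rewrite derive1E; exact: derive_val].
Unshelve. all: by end_near. Qed.

Lemma clamped_derive_const f T t0 s : t0 + T < s ->
  derivable (clamped f t0 T) s 1 /\ derive1 (clamped f t0 T) s = 0.
Proof.
move=> Ts.
have dc : is_derive s 1 (clamped f t0 T) 0.
  apply: (@near_eq_is_derive _ _ _ (cst (f T))).
  near=> z; rewrite /clamped/=; congr f; apply/esym/min_idPr.
  by rewrite lerBrDl; apply: ltW; near: z; exact: lt_nbhsr.
by split; [exact: ex_derive|rewrite derive1E; exact: derive_val].
Unshelve. all: by end_near. Qed.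

End Clamp.

Lemma is_derive_sum_seq {R : realType} (I : Type) (r : seq I) (h : I -> R -> R)
    (dh : I -> R) (x : R) : (forall i, is_derive x 1 (h i) (dh i)) ->
  is_derive x 1 (fun s => \sum_(i <- r) h i s) (\sum_(i <- r) dh i).
Proof.
move=> dhi; elim: r => [|i r IH].
  rewrite big_nil (_ : (fun s => _) = cst 0); first exact: is_derive_cst.
  by apply/funext => s; rewrite big_nil.
rewrite big_cons (_ : (fun s => _) = h i + (fun s => \sum_(j <- r) h j s)).
  exact: is_deriveD.
by apply/funext => s; rewrite big_cons.
Qed.

Lemma is_derive_dot2 {R : realType} (f g h k : R -> R) (x : R) :
  derivable f x 1 -> derivable g x 1 -> derivable h x 1 -> derivable k x 1 ->
  is_derive x 1 (fun s => f s * g s + h s * k s)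
    ((derive1 f x * g x + derive1 h x * k x) +
     (f x * derive1 g x + h x * derive1 k x)).
Proof.
move=> /derivableP df /derivableP dg /derivableP dh /derivableP dk.
have := is_deriveD (is_deriveM df dg) (is_deriveM dh dk).
move=> /is_derive_eq; apply; rewrite -!derive1E /GRing.scale/=; ring.
Qed.

Section MatrixPairing.
Context {R : realType} {p q : nat}.
Local Notation C := R[i].
Implicit Types (A B : R -> 'M[C]_(p, q)).

Lemma mxdotR_ac a b A B : a <= b ->
  mx_parts (abs_continuous a b) A -> mx_parts (abs_continuous a b) B ->
  abs_continuous a b (fun s => mxdotR (A s) (B s)).
Proof.
move=> ab acA acB.
rewrite (_ : (fun s => _) = fun s => \sum_i \sum_j
  (complex.Re (A s i j) * complex.Re (B s i j) +
   complex.Im (A s i j) * complex.Im (B s i j))); last first.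
  by apply/funext => s; rewrite mxdotR_sum.
apply: ac_sum => i; apply: ac_sum => j; have [? ?] := acA i j; have [? ?] := acB i j.
by apply: ac_add; exact: ac_mul.
Qed.

Lemma mxdotR_derive A B s : mxderivable A s -> mxderivable B s ->
  derivable (fun r => mxdotR (A r) (B r)) s 1 /\
  derive1 (fun r => mxdotR (A r) (B r)) s =
    mxdotR (mxderive A s) (B s) + mxdotR (A s) (mxderive B s).
Proof.
move=> dA dB.
have dAB : is_derive s 1 (fun r => mxdotR (A r) (B r))
    (mxdotR (mxderive A s) (B s) + mxdotR (A s) (mxderive B s)).
  rewrite (_ : (fun r => _) = fun r => \sum_i \sum_j
    (complex.Re (A r i j) * complex.Re (B r i j) +
     complex.Im (A r i j) * complex.Im (B r i j))); last first.
    by apply/funext => r; rewrite mxdotR_sum.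
  rewrite !mxdotR_sum -big_split/=; apply: is_derive_sum_seq => i.
  rewrite -big_split/=; apply: is_derive_sum_seq => j.
  have [dA1 dA2] := dA i j; have [dB1 dB2] := dB i j.
  by rewrite !mxE /=; exact: (is_derive_dot2 dA1 dB1 dA2 dB2).
by split; [exact: ex_derive|rewrite derive1E; exact: derive_val].
Qed.

Lemma mxdotR_cvg (F : set_system R) (FF : Filter F) A B (A0 B0 : 'M[C]_(p, q)) :
  (forall i j, complex.Re (A s i j) @[s --> F] --> complex.Re (A0 i j) /\
               complex.Im (A s i j) @[s --> F] --> complex.Im (A0 i j)) ->
  (forall i j, complex.Re (B s i j) @[s --> F] --> complex.Re (B0 i j) /\
               complex.Im (B s i j) @[s --> F] --> complex.Im (B0 i j)) ->
  mxdotR (A s) (B s) @[s --> F] --> mxdotR A0 B0.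
Proof.
move=> cA cB; rewrite mxdotR_sum; under eq_fun do rewrite mxdotR_sum.
apply: (cvg_big (@add_continuous R^o)) => i _.
apply: (cvg_big (@add_continuous R^o)) => j _.
have [? ?] := cA i j; have [? ?] := cB i j.
by apply: cvgD; exact: cvgM.
Qed.

End MatrixPairing.

Section ClampedMatrices.
Context {R : realType} {p q : nat}.
Local Notation C := R[i].
Local Notation mu := (@lebesgue_measure R).
Implicit Types (P : R -> 'M[C]_(p, q)).

Lemma ae_derivable_piecewise_C1 (f : R -> R) T t0 : piecewise_C1 0 T f ->
  {ae mu, forall s, t0 < s < t0 + T -> derivable f (s - t0) 1}.
Proof.
move=> /piecewise_C1_lipschitz[_ [r fr]].
have := ae_notin_seq [seq x + t0 | x <- r].
apply: filterS; first exact: (ae_filter_ringOfSetsType mu).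
move=> s sr /andP[ts sT]; apply: fr; first by rewrite subr_gt0 ts ltrBlDl.
by apply: contra sr => sr; apply/mapP; exists (s - t0) => //; rewrite subrK.
Qed.

Lemma ae_mxderivable_piecewise_C1 P T t0 : mx_parts (piecewise_C1 0 T) P ->
  {ae mu, forall s, t0 < s < t0 + T -> mxderivable P (s - t0)}.
Proof.
move=> PC; pose aeF := ae_filter_ringOfSetsType mu.
have : {ae mu, forall s i j, t0 < s < t0 + T ->
    derivable (fun r => complex.Re (P r i j)) (s - t0) 1 /\
    derivable (fun r => complex.Im (P r i j)) (s - t0) 1}.
  apply: (@filter_forall _ _ _ _ aeF) => i; apply: (@filter_forall _ _ _ _ aeF) => j.
  have [reC imC] := PC i j.
  have reP := ae_derivable_piecewise_C1 t0 reC.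
  have imP := ae_derivable_piecewise_C1 t0 imC.
  by move: reP imP; apply: filterS2 => s reP imP sT; split; [exact: reP|exact: imP].
by apply: filterS => s Ps sT i j; exact: Ps.
Qed.

Lemma clamped_mxderive P T t0 s : mxderivable P (s - t0) -> s < t0 + T ->
  mxderivable (clamped P t0 T) s /\ mxderive (clamped P t0 T) s = mxderive P (s - t0).
Proof.
move=> dP sT; split => [i j|].
  by have [dre dim] := dP i j; split;
    [exact: (clamped_derive dre sT).1|exact: (clamped_derive dim sT).1].
apply/matrixP => i j; rewrite !mxE.
by have [/clamped_derive/(_ sT)[_ <-] /clamped_derive/(_ sT)[_ <-]] := dP i j.
Qed.

Lemma clamped_mxderive_const P T t0 s : t0 + T < s ->
  mxderivable (clamped P t0 T) s /\ mxderive (clamped P t0 T) s = 0.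
Proof.
move=> Ts; split => [i j|].
  by split; [exact: (clamped_derive_const (fun r => complex.Re (P r i j)) Ts).1|
             exact: (clamped_derive_const (fun r => complex.Im (P r i j)) Ts).1].
apply/matrixP => i j; rewrite !mxE.
have [_ E1] := clamped_derive_const (fun r => complex.Re (P r i j)) Ts.
have [_ E2] := clamped_derive_const (fun r => complex.Im (P r i j)) Ts.
by move: E1 E2; rewrite /clamped => -> ->.
Qed.

End ClampedMatrices.

(** * Dissipation and summation over the cycles *)

Section Certificate.
Context {R : realType} {n m : nat}.
Local Notation C := R[i].
Local Notation mu := (@lebesgue_measure R).

Lemma psdmx_state (X : 'M[C]_(n + m)) : psdmx X -> psdmx (state X).
Proof.
move=> [/hermsymmx_ctrmx hX X0]; split.
  by apply/hermsymmx_ctrmx; rewrite /state !ctrmxM ctrmxK hX mulmxA.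
by move=> v; have := X0 ((Emx R n m)^t* *m v); rewrite ctrmxM ctrmxK /state !mulmxA.
Qed.

(** The adjoint identity behind both C_Z (with [Q] the derivative of the certificate)
    and D_Z (with [Q] the opposite of its value before the jump). *)
Lemma energy_balance (F : 'M[C]_(n + m) -> 'M[C]_n) Fadj (Q P : 'M[C]_n)
    (X Z : 'M[C]_(n + m)) :
  herm_operator F Fadj -> P \is hermsymmx -> X \is hermsymmx ->
  mxdotR Q (state X) + mxdotR P (F X) =
  mxdotR ((Emx R n m)^t* *m Q *m Emx R n m + Fadj P + Z) X - mxdotR Z X.
Proof.
move=> HF hP hX; rewrite !mxdotRDl addrK; congr (_ + _).
  by rewrite /mxdotR mxdot_state.
by rewrite /mxdotR (herm_adjoint HF).
Qed.

Section Trajectories.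
Context (Sys : hybrid_system R n m) (Finf : 'M[C]_(n + m) -> 'M[C]_n)
  (Finf_adj : 'M[C]_n -> 'M[C]_(n + m)) (Tmin : R) (Ps : R -> 'M[C]_n).
Context (Sys_axioms : hybrid_axioms Sys) (Tmin_gt0 : 0 < Tmin)
  (Finf_operator : herm_operator Finf Finf_adj)
  (flow_stationary : forall tau X, Tmin <= tau -> X \is hermsymmx ->
     flow Sys tau X = Finf X)
  (flow_cost_stationary : forall tau, Tmin <= tau ->
     flow_cost Sys tau = flow_cost Sys Tmin)
  (Ps_C1 : mx_parts (piecewise_C1 0 Tmin) Ps)
  (Ps_psd : forall tau, 0 <= tau <= Tmin -> psdmx (Ps tau))
  (cond_flow : forall tau, 0 < tau < Tmin -> mxderivable Ps tau ->
     psdmx (C_Z Sys tau Ps) /\ schur (C_Z Sys tau Ps) = 0)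
  (cond_jump : psdmx (D_Z Sys (Ps 0) (Ps Tmin)) /\
     schur (D_Z Sys (Ps 0) (Ps Tmin)) = 0)
  (cond_stab : nsdmx (Finf_adj (Ps Tmin) + flow_cost Sys Tmin)).
Context (K : R -> 'M[C]_(m, n)) (Kj : nat -> 'M[C]_(m, n))
  (K_flow : forall tau, 0 <= tau <= Tmin -> K_c Sys tau Ps (K tau))
  (K_jump : forall k, (0 < k)%N -> K_d Sys (Ps 0) (Ps Tmin) (Kj k)).

Lemma flow_dissipation tau X : 0 < tau < Tmin -> mxderivable Ps tau -> psdmx X ->
  uses_gain (K tau) X ->
  mxdotR (mxderive Ps tau) (state X) + mxdotR (Ps tau) (flow Sys tau X) =
  - mxdotR (flow_cost Sys tau) X.
Proof.
move=> /andP[t0 tT] dP [hX _] KX.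
have tauT : 0 <= tau <= Tmin by rewrite !ltW.
have [[hC _] sC] : psdmx (C_Z Sys tau Ps) /\ schur (C_Z Sys tau Ps) = 0.
  by apply: cond_flow => //; rewrite t0.
have [hP _] := Ps_psd tauT.
have flow_adjoint := flow_operator Sys_axioms (ltW t0).
rewrite (energy_balance _ (flow_cost Sys tau) flow_adjoint hP hX).
by rewrite {1}/mxdotR (mxdot_gain_eq0 hC sC (K_flow tauT) hX KX)/= add0r.
Qed.

(** Beyond [Tmin] the inequality holds whatever the input, the stability condition
    being a matrix inequality. *)
Lemma late_dissipation tau X : Tmin <= tau -> psdmx X ->
  mxdotR (Ps Tmin) (flow Sys tau X) <= - mxdotR (flow_cost Sys tau) X.
Proof.
move=> Tt pX; have [hX _] := pX.
have [hP _] : psdmx (Ps Tmin) by apply: Ps_psd; rewrite lexx ltW.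
rewrite flow_stationary// flow_cost_stationary//.
have := energy_balance 0 (flow_cost Sys Tmin) Finf_operator hP hX.
have := mxdotR_psd_ge0 cond_stab pX.
rewrite mulmx0 mul0mx add0r mxdotRNl => H.
rewrite {1}/mxdotR /mxdot mul0mx linear0 add0r => ->.
lra.
Qed.

Lemma jump_dissipation k X : (0 < k)%N -> psdmx X -> uses_gain (Kj k) X ->
  mxdotR (Ps 0) (jump Sys X) =
  mxdotR (Ps Tmin) (state X) - mxdotR (jump_cost Sys) X.
Proof.
move=> k0 [hX _] KX.
have [hP _] : psdmx (Ps 0) by apply: Ps_psd; rewrite lexx ltW.
have [[hD _] sD] := cond_jump.
have := energy_balance (- Ps Tmin) (jump_cost Sys) (jump_operator Sys_axioms) hP hX.
rewrite mulmxN mulNmx [- _ + _]addrC -/(D_Z Sys (Ps 0) (Ps Tmin)).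
rewrite [X in _ = X - _]/mxdotR (mxdot_gain_eq0 hD sD (K_jump k0) hX KX)/= mxdotRNl.
lra.
Qed.

Context (t : nat -> R) (X10 : 'M[C]_n) (X : R -> 'M[C]_(n + m))
  (Xm : nat -> 'M[C]_(n + m)).
Context (t_jump : jump_times t) (dwell : forall k, Tmin <= t k.+1 - t k)
  (X_traj : trajectory Sys t X10 X Xm) (X_follows : follows (gain_policy K Kj) t X Xm).

Let flow_integrand s := mxdotR (flow_cost Sys (timer t s)) (X s).

Lemma initial_time_le k : t 0%N <= t k.
Proof. by elim: k => // k /le_trans; apply; apply: ltW; case: t_jump. Qed.

Lemma flow_integrand_ge0 s : t 0%N <= s -> 0 <= flow_integrand s.
Proof.
move=> ts; have [k ks] := timer_exists t_jump ts.
apply: mxdotR_psd_ge0; last exact: (traj_psd X_traj).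
apply: (flow_cost_psd Sys_axioms); rewrite (timerE t_jump ks) subr_ge0.
by case/andP: ks.
Qed.

(** Integration of the dissipation inequality. The state equation is available on
    each [t k, b] with b < t_{k+1} only, and the left limit of the state at t_{k+1}
    is that of the pre-jump value [Xm k.+1]. *)
Lemma cycle_cost k :
  (\int[mu]_(s in `[t k, t k.+1[) (flow_integrand s)%:E <=
   (mxdotR (Ps 0) (state (X (t k))) - mxdotR (Ps Tmin) (state (Xm k.+1)))%:E)%E.
Proof.
have tk : t k < t k.+1 by case: t_jump.
have t0k := initial_time_le k.
pose V s := mxdotR (clamped Ps (t k) Tmin s) (state (X s)).
have -> : mxdotR (Ps 0) (state (X (t k))) = V (t k).
  by rewrite /V /clamped subrr (_ : Num.min _ _ = 0)//; apply/min_idPl/ltW.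
apply: ac_integral_left_limit_le => //.
- move=> b /andP[kb bk]; apply: mxdotR_ac => //.
    by move=> i j; have [? ?] := Ps_C1 i j; split;
      apply: (clamped_ac _ _ (f := fun s => _ (Ps s i j))) => //; exact: ltW.
  by have [] := traj_flow X_traj (b := b) (k := k); rewrite ?kb.
- apply: measurable_funS (traj_cost_measurable X_traj) => // s /=.
  by rewrite !in_itv/= andbT => /andP[/(le_trans t0k)].
- by move=> s /andP[ks _]; apply: flow_integrand_ge0; exact: le_trans ks.
- move=> b /andP[kb bk].
  have [|_ flow_ae] := traj_flow X_traj (b := b) (k := k); first by rewrite kb.
  have Ps_ae : {ae mu, forall s, t k < s < t k + Tmin -> mxderivable Ps (s - t k)}.
    exact: ae_mxderivable_piecewise_C1.
  (* At the instant where the certificate freezes it may fail to be derivable. *)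
  have := ae_notin_seq [:: t k + Tmin].
  move: flow_ae Ps_ae; apply: filterS3; first exact: (ae_filter_ringOfSetsType mu).
  move=> s flow_s Ps_s; rewrite inE => sT /andP[ks sb].
  have [|dX X'] := flow_s _; first by rewrite ks.
  have t0s : t 0%N <= s by rewrite (le_trans t0k)// ltW.
  have tau : timer t s = s - t k by apply: timerE; rewrite // ltW//= (lt_trans sb).
  have pX := traj_psd X_traj t0s.
  have [sT'|Ts] := ltP s (t k + Tmin).
    have dP : mxderivable Ps (s - t k) by apply: Ps_s; rewrite ks.
    have [dV ->] : derivable V s 1 /\ derive1 V s =
        mxdotR (mxderive Ps (s - t k)) (state (X s)) +
        mxdotR (Ps (s - t k)) (flow Sys (timer t s) (X s)).
      have [dcP cP'] := clamped_mxderive dP sT'.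
      have [dV V'] := mxdotR_derive dcP dX; split => //.
      rewrite V' X' cP' /clamped (_ : Num.min _ _ = s - t k)//.
      by apply/min_idPl; rewrite lerBlDl ltW.
    split => //; rewrite /flow_integrand tau flow_dissipation//.
      by rewrite subr_gt0 ks ltrBlDl.
    by have := X_follows.1 _ t0s; rewrite /= tau.
  have {}Ts : t k + Tmin < s by rewrite lt_neqAle Ts eq_sym sT.
  have [dV ->] : derivable V s 1 /\ derive1 V s =
      mxdotR (Ps Tmin) (flow Sys (timer t s) (X s)).
    have [dcP cP'] := clamped_mxderive_const Ps Ts.
    have [dV V'] := mxdotR_derive dcP dX; split => //.
    rewrite V' X' cP' /clamped (_ : Num.min _ _ = Tmin); last first.
      by apply/min_idPr; rewrite lerBrDl ltW.
    by rewrite {1}/mxdotR /mxdot mul0mx linear0 add0r.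
  by split => //; apply: late_dissipation => //; rewrite tau lerBrDl ltW.
- apply: mxdotR_cvg => i j; last exact: traj_left_limit X_traj k i j.
  have [? ?] := Ps_C1 i j; have Tk : t k + Tmin <= t k.+1 by rewrite -lerBrDl.
  split; [exact: (clamped_left_limit (f := fun s => complex.Re (Ps s i j)))|
    exact: (clamped_left_limit (f := fun s => complex.Im (Ps s i j)))].
Qed.

Lemma sume_nat_recr (u : nat -> \bar R) (P : pred nat) N : P N ->
  (\sum_(0 <= k < N.+1 | P k) u k = \sum_(0 <= k < N | P k) u k + u N)%E.
Proof. by move=> PN; rewrite big_mkcond big_nat_recr// -big_mkcond PN. Qed.

Lemma telescope (a b c d : R) :
  ((a - b)%:E + ((b - c)%:E + d%:E) <= (a - (c - d))%:E)%E.
Proof. by rewrite -!EFinD lee_fin; lra. Qed.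

(** Telescoping. The sum runs up to and including the jump at [t N], the value at
    [t N] being post-jump; the condition on [t k] removes the index 0, which is not a
    jump. *)
Lemma finite_horizon_cost N :
  (\int[mu]_(s in `[t 0%N, t N[) (flow_integrand s)%:E +
   \sum_(0 <= k < N.+1 | (t 0%N < t k)%R) (mxdotR (jump_cost Sys) (Xm k))%:E <=
   (mxdotR (Ps 0) X10 - mxdotR (Ps 0) (state (X (t N))))%:E)%E.
Proof.
elim: N => [|N IH].
  rewrite set_itvco0 integral_set0 add0e big_mkcond big_nat1 ltxx.
  by rewrite (traj_init X_traj) subrr.
have tN : t N < t N.+1 by case: t_jump.
have t0N := initial_time_le N.
have sub s : s \in `[t 0%N, t N.+1[ -> t 0%N <= s.
  by rewrite in_itv/= => /andP[].
have split_itv : `[t 0%N, t N.+1[%classic =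
    `[t 0%N, t N[%classic `|` `[t N, t N.+1[%classic.
  by rewrite -itv_bndbnd_setU// bnd_simp ltW.
have -> : (\int[mu]_(s in `[t 0%N, t N.+1[) (flow_integrand s)%:E =
    \int[mu]_(s in `[t 0%N, t N[) (flow_integrand s)%:E +
    \int[mu]_(s in `[t N, t N.+1[) (flow_integrand s)%:E)%E.
  rewrite split_itv ge0_integral_setU -?split_itv//.
  - apply/measurable_EFinP; apply: measurable_funS (traj_cost_measurable X_traj) => //.
    by move=> s /= /sub; rewrite in_itv/= andbT.
  - by move=> s /= /sub; rewrite lee_fin; exact: flow_integrand_ge0.
  - apply/disj_setPS => s [] /=; rewrite !in_itv/= => /andP[_ sN] /andP[Ns _].
    by move: (lt_le_trans sN Ns); rewrite ltxx.
rewrite (sume_nat_recr _ (le_lt_trans t0N tN)) addeACA.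
apply: le_trans (leeD IH (leeD (cycle_cost N) (lexx _))) _.
have Xm_jump := jump_dissipation (ltn0Sn N) (traj_pre_psd X_traj N) (X_follows.2 N).
rewrite (traj_jump X_traj) Xm_jump; exact: telescope.
Qed.

(** The partial costs increase to the infinite-horizon cost, and the energy left at
    [t N] is nonnegative. *)
Lemma cost_infty_le : (cost_infty Sys t X Xm <= (mxdotR (Ps 0) X10)%:E)%E.
Proof.
pose J k := (mxdotR (jump_cost Sys) (Xm k))%:E.
have J0 k : (0 <= k)%N -> t 0%N < t k -> (0 <= J k)%E.
  case: k => [_|k _ _]; first by rewrite ltxx.
  rewrite lee_fin; apply: mxdotR_psd_ge0; first exact: jump_cost_psd Sys_axioms.
  exact: traj_pre_psd X_traj k.
have Jcvg : (\sum_(0 <= k < N.+1 | (t 0%N < t k)%R) J k)%E @[N --> \oo] -->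
    (\sum_(0 <= k <oo | (t 0%N < t k)%R) J k)%E.
  have := @is_cvg_nneseries _ J (fun k => t 0%N < t k) 0 J0.
  by rewrite -(cvg_shiftS (fun N => \sum_(0 <= k < N | (t 0%N < t k)%R) J k)%E).
have t_mono : {homo t : i j / (i <= j)%N >-> i <= j}.
  by apply: homo_leq => //; [exact: le_trans|move=> i; apply: ltW; case: t_jump].
have tE : (\bigcup_N `[t 0%N, t N[%classic) = `[t 0%N, +oo[%classic.
  apply/seteqP; split => s /=.
    by move=> [N _] /=; rewrite !in_itv/= andbT => /andP[].
  rewrite in_itv/= andbT => ts; have [k /andP[ks sk]] := timer_exists t_jump ts.
  by exists k.+1 => //=; rewrite in_itv/= ts.
have nnd : {homo (fun N => `[t 0%N, t N[%classic) : i j / (i <= j)%N >-> (i <= j)%O}.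
  by move=> i j ij; apply/subsetPset/subset_itvl; rewrite bnd_simp t_mono.
have mI N : measurable_fun `[t 0%N, t N[ (EFin \o flow_integrand).
  apply/measurable_EFinP; apply: measurable_funS (traj_cost_measurable X_traj) => // s /=.
  by rewrite !in_itv/= andbT => /andP[].
have I0 N s : s \in `[t 0%N, t N[ -> (0 <= (EFin \o flow_integrand) s)%E.
  by rewrite in_itv/= => /andP[ts _]; rewrite lee_fin flow_integrand_ge0.
have := @ge0_nondecreasing_set_cvg_integral _ (measurableTypeR R) R _
  (EFin \o flow_integrand) mu nnd (fun=> measurable_itv _) mI I0.
rewrite tE => Icvg.
have cvg_cost : (\int[mu]_(s in `[t 0%N, t N[) (flow_integrand s)%:E +
    \sum_(0 <= k < N.+1 | (t 0%N < t k)%R) J k)%E @[N --> \oo] -->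
    cost_infty Sys t X Xm.
  apply: cvgeD; [|exact: Icvg|exact: Jcvg].
  apply: ge0_adde_def; rewrite inE; last by apply: nneseries_ge0.
  by apply: integral_ge0 => s /=; rewrite in_itv/= andbT lee_fin; exact: flow_integrand_ge0.
rewrite -(cvg_lim _ cvg_cost)//; apply: lime_le.
  by apply/cvg_ex; eexists; exact: cvg_cost.
apply: nearW => N; apply: le_trans (finite_horizon_cost N) _.
rewrite lee_fin gerBl; apply: mxdotR_psd_ge0; first by apply: Ps_psd; rewrite lexx ltW.
apply: psdmx_state; apply: traj_psd X_traj _ _; exact: initial_time_le.
Qed.

Lemma cost_T_le_infty T : (cost_T Sys t X Xm T <= cost_infty Sys t X Xm)%E.
Proof.
apply: leeD.
  apply: ge0_subset_integral => //.
  - apply/measurable_EFinP; exact: traj_cost_measurable X_traj.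
  - by move=> s /=; rewrite in_itv/= andbT lee_fin; exact: flow_integrand_ge0.
  - by move=> s /=; rewrite !in_itv/= => /andP[->].
apply: subset_lee_nneseries => i.
  by case: i => [|i]; [rewrite ltxx|rewrite lee_fin => _; apply: mxdotR_psd_ge0;
    [exact: jump_cost_psd Sys_axioms|exact: traj_pre_psd X_traj i]].
by case/andP.
Qed.

End Trajectories.
End Certificate.

(** * The dwell-time cost bound *)

Theorem theorem3p19 (R : realType) (n m : nat) (Sys : hybrid_system R n m)
    (Finf : 'M[R[i]]_(n + m) -> 'M[R[i]]_n)
    (Finf_adj : 'M[R[i]]_n -> 'M[R[i]]_(n + m))
    (Tmin : R) (Ps : R -> 'M[R[i]]_n)
    (n_ge1 : (1 <= n)%N) (m_ge1 : (1 <= m)%N)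
    (Sys_axioms : hybrid_axioms Sys)
    (Tmin_gt0 : 0 < Tmin)
    (Finf_operator : herm_operator Finf Finf_adj)
    (flow_stationary : forall tau X, Tmin <= tau -> X \is hermsymmx ->
       flow Sys tau X = Finf X)
    (flow_cost_stationary : forall tau, Tmin <= tau ->
       flow_cost Sys tau = flow_cost Sys Tmin)
    (Ps_C1 : mx_parts (piecewise_C1 0 Tmin) Ps)
    (Ps_psd : forall tau, 0 <= tau <= Tmin -> psdmx (Ps tau))
    (cond_flow : forall tau, 0 < tau < Tmin -> mxderivable Ps tau ->
       psdmx (C_Z Sys tau Ps) /\ schur (C_Z Sys tau Ps) = 0)
    (cond_jump : psdmx (D_Z Sys (Ps 0) (Ps Tmin)) /\
       schur (D_Z Sys (Ps 0) (Ps Tmin)) = 0)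
    (cond_stab : nsdmx (Finf_adj (Ps Tmin) + flow_cost Sys Tmin))
    (K : R -> 'M[R[i]]_(m, n)) (Kj : nat -> 'M[R[i]]_(m, n))
    (K_flow : forall tau, 0 <= tau <= Tmin -> K_c Sys tau Ps (K tau))
    (K_stationary : forall tau, Tmin < tau -> K tau = K Tmin)
    (K_jump : forall k, (0 < k)%N -> K_d Sys (Ps 0) (Ps Tmin) (Kj k)) :
  causal (gain_policy K Kj) /\
  forall (t : nat -> R) (X10 : 'M[R[i]]_n)
    (X : R -> 'M[R[i]]_(n + m)) (Xm : nat -> 'M[R[i]]_(n + m)),
    jump_times t -> (forall k, Tmin <= t k.+1 - t k) ->
    psdmx X10 ->
    trajectory Sys t X10 X Xm -> follows (gain_policy K Kj) t X Xm ->
    (forall T, 0 < T -> (cost_T Sys t X Xm T <= (mxdotR (Ps 0) X10)%:E)%E) /\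
    (optimal_cost Sys t X10 <= (mxdotR (Ps 0) X10)%:E)%E.
Proof.
split.
  move=> t t' x x' xm xm' tj tj' t00; split => // s t0s tt' xmE xE.
  (* The jump gain depends on the index of the jump alone; the flow gain is the case of
     a feedback that ignores the state. *)
  have pol_causal :=
    timer_state_causal (fun _ : 'M[R[i]]_n => K) (fun _ : 'M[R[i]]_n => K).
  have [H _] := pol_causal t t' x x' xm xm' tj tj' t00.
  exact: H t0s tt' xmE xE.
move=> t X10 X Xm t_jump dwell _ X_traj X_follows.
have cost_le : (cost_infty Sys t X Xm <= (mxdotR (Ps 0) X10)%:E)%E.
  exact: (cost_infty_le Sys_axioms Tmin_gt0 Finf_operator flow_stationary
    flow_cost_stationary Ps_C1 Ps_psd cond_flow cond_jump cond_stab K_flow K_jump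
    t_jump dwell X_traj X_follows).
split=> [T _|].
  exact: le_trans (cost_T_le_infty Sys_axioms t_jump X_traj T) cost_le.
apply: le_trans cost_le; apply: ereal_inf_lbound; by exists X, Xm.
Qed.
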